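(* Let $\mathcal{H}$ be a complex Hilbert space and let $A \in \mathcal{B}(\mathcal{H})$. Then $$w^4(A)\geq \frac{1}{16}\left\|(A^*A+AA^* )^2+4\left(\Re(A^2)\right)^2\right\|+\frac{1}{2}\Big|\,\|\Re(A)\|^4-\|\Im(A)\|^4\,\Big|$$ and $$\frac{1}{16}\left\|(A^*A+AA^* )^2+4\left(\Re(A^2)\right)^2\right\|+\frac{1}{2}\Big|\,\|\Re(A)\|^4-\|\Im(A)\|^4\,\Big|\geq \frac{1}{16}\|A^*A+AA^*\|^2+\frac{1}{4}c\left(\left(\Re(A^2)\right)^2\right)+\frac{1}{2}\Big|\,\|\Re(A)\|^4-\|\Im(A)\|^4\,\Big|.$$
   Context: $\mathcal{B}(\mathcal{H})$ denotes the algebra of all bounded linear operators on the complex Hilbert space $\mathcal{H}$, with operator norm $\|\cdot\|$ and adjoint $A^*$. The numerical radius is $w(A)=\sup\{|\langle Ax,x\rangle| : x\in\mathcal{H},\ \|x\|=1\}$, with $w^4(A)=(w(A))^4$, and the Crawford number is $c(A)=\inf\{|\langle Ax,x\rangle| : x\in\mathcal{H},\ \|x\|=1\}$. For $T\in\mathcal{B}(\mathcal{H})$, the real and imaginary parts are the operators $\Re(T)=\frac{T+T^*}{2}$ and $\Im(T)=\frac{T-T^*}{2\mathrm{i}}$. *)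

(* Defs.v *)
From HB Require Import structures.
From mathcomp Require Import all_boot all_order all_algebra.
From mathcomp Require Import all_classical all_reals all_analysis.
From mathcomp Require Export sesquilinear complex.
Set Implicit Arguments.
Unset Strict Implicit.
Unset Printing Implicit Defensive.

Import Order.TTheory GRing.Theory Num.Theory Num.Def.
Import numFieldNormedType.Exports.
Local Open Scope classical_set_scope.
Local Open Scope ring_scope.

(* A complex Hilbert space is a complete normed module H over R[i] together
   with a positive definite hermitian form [dot] (linear in its first argument,
   conjugate-linear in the second) that induces the norm of H:
   [inner_product_norm dot]. *)
Definition inner_product_norm (R : realType) (H : completeNormedModType R[i])
    (dot : {dot H for conjC}) :=
  forall x : H, `|x| ^+ 2 = dot x x.

Definition bounded_operator (R : realType) (H : completeNormedModType R[i])
    (T : H -> H) :=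
  linear T /\ exists M : R, forall x : H, `|T x| <= M%:C%C * `|x|.

Section Operators.
Context (R : realType) (H : completeNormedModType R[i]).
Implicit Types T : H -> H.

(* Norms over R[i] take their values in R[i], and are real; [complex.Re] only
   reads them as elements of R. *)
Definition opnorm T : R :=
  sup [set complex.Re `|T x| | x in [set x : H | `|x| <= 1]].

Context (dot : {dot H for conjC}).

Definition numerical_radius T : R :=
  sup [set complex.Re `|dot (T x) x| | x in [set x : H | `|x| = 1]].

Definition crawford T : R :=
  inf [set complex.Re `|dot (T x) x| | x in [set x : H | `|x| = 1]].

(* The value T^* y is the z, unique when it exists, such that
   <T x, y> = <x, z> for all x; it exists for every y when T is bounded.
   The default 0 is used only for operators without an adjoint. *)
Definition adjoint T : H -> H :=
  fun y => xget 0 [set z | forall x, dot (T x) y = dot x z].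

Definition re_op T : H -> H := 2^-1 *: (T + adjoint T).

Definition im_op T : H -> H := (2 * 'i)^-1 *: (T - adjoint T).

End Operators.

(* Main.v *)
(* Write A = B + iC with B = Re A and C = Im A selfadjoint, of norm at most w(A)
   because <Bx, x> and <Cx, x> are the real and imaginary parts of <Ax, x>.
   Let A' be the adjoint of A. Then P = A'A + AA' = 2(B^2 + C^2) and
   Q = Re(A^2) = B^2 - C^2, so that P^2 + 4Q^2 = 8(B^4 + C^4), whose norm is at
   most 8(b + c) with b = |B|^4 and c = |C|^4. The first inequality is then
   (b + c + |b - c|)/2 = max(b, c). The second follows from
   <(P^2 + 4Q^2)x, x> = |Px|^2 + 4<Q^2 x, x>. *)
Require Import Defs.
From mathcomp Require Import all_boot all_order all_algebra.
From mathcomp Require Import all_classical all_reals all_analysis.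
From mathcomp Require Import ring lra.
Import Order.TTheory GRing.Theory Num.Theory Num.Def.
Import numFieldNormedType.Exports.
Local Open Scope ring_scope.

(** * Real-valued norms, bounded operators and the operator norm *)

Section BoundedOperators.
Set Implicit Arguments.
Unset Strict Implicit.
Context (R : realType) (H : completeNormedModType R[i]).
Implicit Types (x y : H) (c : R[i]) (T U : H -> H).

(** Working in the ordered field [R] rather than in [R[i]] lets [lra] and [nra] handle the
    estimates. *)
Definition rnorm x : R := complex.Re `|x|.

Lemma rnormE x : `|x| = (rnorm x)%:C%C.
Proof. by rewrite /rnorm RRe_real// normr_real. Qed.

Lemma rnorm_ge0 x : 0 <= rnorm x.
Proof. by rewrite -lecR -rnormE normr_ge0. Qed.

Lemma rnorm0 : rnorm 0 = 0.
Proof. by rewrite /rnorm normr0. Qed.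

Lemma rnorm_eq0 x : (rnorm x == 0) = (x == 0).
Proof. by rewrite -(normr_eq0 x) rnormE -(inj_eq (@complexI R)). Qed.

Lemma rnormN x : rnorm (- x) = rnorm x.
Proof. by rewrite /rnorm normrN. Qed.

Lemma rnormD x y : rnorm (x + y) <= rnorm x + rnorm y.
Proof. by rewrite -lecR rmorphD /= -!rnormE ler_normD. Qed.

Lemma rnormZ c x : rnorm (c *: x) = complex.Re `|c| * rnorm x.
Proof.
apply: complexI; rewrite -rnormE normrZ rnormE rmorphM/=.
by rewrite RRe_real ?normr_real.
Qed.

Lemma rnormZ_real (t : R) x : rnorm (t%:C%C *: x) = `|t| * rnorm x.
Proof. by rewrite rnormZ normc_def/= expr0n/= addr0 sqrtr_sqr. Qed.

(** In [R[i]], [0 < e] forces the imaginary part of [e] to vanish, so Cauchy filters and limits can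
    be tested with real tolerances. Comparing with the single term [u N] is the form that
    [cauchy_exP] asks for. *)
Lemma rnorm_complete (u : nat -> H) :
  (forall e : R, 0 < e ->
    exists N, forall n, (N <= n)%N -> rnorm (u N - u n) < e) ->
  exists z, forall e : R, 0 < e ->
    exists N, forall n, (N <= n)%N -> rnorm (u n - z) < e.
Proof.
have realE (e : R[i]) : 0 < e -> exists2 r : R, 0 < r & e = r%:C%C.
  move=> e0; exists (complex.Re e); last by rewrite RRe_real ?gtr0_real.
  by move: e0; rewrite ltcE => /andP[].
move=> cu.
have /cauchy_cvg/cvg_ex[z /cvgrPdist_lt uz] : cauchy (u @ \oo)%classic.
  apply: cauchy_exP => e /realE[r r0 ->].
  have [N uN] := cu _ r0; exists (u N), N => // n /= Nn.
  by rewrite -ball_normE /ball_/= rnormE ltcR uN.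
exists z => e e0.
have [|N _ uN] := uz e%:C%C; first by rewrite ltcR.
exists N => n Nn; rewrite -ltcR -rnormE distrC.
exact: uN.
Qed.

Lemma linear_opD T x y : linear T -> T (x + y) = T x + T y.
Proof. by move=> /(_ 1 x y); rewrite !scale1r. Qed.

Lemma linear_op0 T : linear T -> T 0 = 0.
Proof. by move=> /(_ (-1) 0 0); rewrite !scaleN1r addr0 oppr0 addNr. Qed.

Lemma linear_opZ T (a : R[i]) x : linear T -> T (a *: x) = a *: T x.
Proof. by move=> lT; rewrite -[a *: x]addr0 lT linear_op0// addr0. Qed.

Lemma linear_opN T x : linear T -> T (- x) = - T x.
Proof. by move=> lT; rewrite -scaleN1r linear_opZ// scaleN1r. Qed.

(** Bundled as a product so that one repeated rewrite pushes a linear map through sums, opposites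
    and scalars. *)
Lemma linear_opE T : linear T ->
  {morph T : x y / x + y} * {morph T : x / - x} *
  (forall (a : R[i]) x, T (a *: x) = a *: T x).
Proof.
move=> lT; split; first by split=> x *; rewrite (linear_opD, linear_opN).
by move=> a x; rewrite linear_opZ.
Qed.

Lemma bounded_operatorP T : bounded_operator T <->
  linear T /\ exists2 M : R, 0 <= M & forall x, rnorm (T x) <= M * rnorm x.
Proof.
split=> -[lT [M]] => [TM|M0 TM]; split=> //.
  exists `|M| => // x.
  rewrite (le_trans _ (ler_wpM2r _ (ler_norm M))) ?rnorm_ge0//.
  by rewrite -lecR rmorphM/= -!rnormE.
by exists M => x; rewrite !rnormE -rmorphM lecR.
Qed.

Lemma bounded_operatorD T U :
  bounded_operator T -> bounded_operator U -> bounded_operator (T + U).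
Proof.
move=> /bounded_operatorP[lT [M M0 TM]] /bounded_operatorP[lU [N N0 UN]].
apply/bounded_operatorP; split.
  (* Unfolding exposes the pointwise sum of functions; the additions of [H] are then folded back. *)
  move=> a x y; rewrite /GRing.add/= -!/(GRing.add _ _).
  by rewrite lT lU scalerDr addrACA.
exists (M + N) => [|x]; first exact: addr_ge0.
by rewrite mulrDl (le_trans (rnormD _ _))// lerD.
Qed.

Lemma bounded_operatorZ (a : R[i]) T :
  bounded_operator T -> bounded_operator (a *: T).
Proof.
move=> /bounded_operatorP[lT [M M0 TM]].
have a0 : 0 <= complex.Re `|a| by rewrite -lecR RRe_real ?normr_real ?normr_ge0.
apply/bounded_operatorP; split.
  move=> b x y; rewrite [LHS](_ : _ = a *: T (b *: x + y))//.
  by rewrite lT scalerDr !scalerA mulrC.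
exists (complex.Re `|a| * M) => [|x]; first exact: mulr_ge0.
by rewrite [X in X <= _]rnormZ -mulrA ler_wpM2l.
Qed.

Lemma bounded_operatorN T : bounded_operator T -> bounded_operator (- T).
Proof. by rewrite -scaleN1r; exact: bounded_operatorZ. Qed.

Lemma bounded_operator_comp T U :
  bounded_operator T -> bounded_operator U -> bounded_operator (T \o U).
Proof.
move=> /bounded_operatorP[lT [M M0 TM]] /bounded_operatorP[lU [N N0 UN]].
apply/bounded_operatorP; split; first by move=> a x y /=; rewrite lU lT.
exists (M * N) => [|x]; first exact: mulr_ge0.
by rewrite (le_trans (TM _))// -mulrA ler_wpM2l.
Qed.

Lemma opnorm_le T (M : R) : 0 <= M -> (forall x, rnorm (T x) <= M * rnorm x) ->
  opnorm T <= M.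
Proof.
move=> M0 TM; apply: ge_sup.
  (* The vector 0 lies in the unit ball, so the supremum is over a nonempty set even when [H] is
     trivial. *)
  by exists (rnorm (T 0)), 0; rewrite //= normr0.
move=> _ [x /= x1 <-]; apply: le_trans (TM x) _.
by rewrite ler_piMr// -lecR -rnormE.
Qed.

Lemma opnorm_ub T x :
  bounded_operator T -> `|x| <= 1 -> rnorm (T x) <= opnorm T.
Proof.
move=> /bounded_operatorP[lT [M M0 TM]] x1.
apply: ub_le_sup; last by exists x.
exists M => _ [y /= y1 <-]; apply: le_trans (TM y) _.
by rewrite ler_piMr// -lecR -rnormE.
Qed.

Lemma opnorm_ge0 T : bounded_operator T -> 0 <= opnorm T.
Proof.
move=> bT; apply: le_trans (opnorm_ub (x := 0) bT _); first exact: rnorm_ge0.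
by rewrite normr0.
Qed.

Lemma rnorm_le_opnorm T x :
  bounded_operator T -> rnorm (T x) <= opnorm T * rnorm x.
Proof.
move=> bT; have [lT _] := bT.
have [->|x0] := eqVneq x 0; first by rewrite linear_op0// rnorm0 mulr0.
have r0 : 0 < rnorm x by rewrite lt0r rnorm_eq0 x0 rnorm_ge0.
have := @opnorm_ub T ((rnorm x)^-1%:C%C *: x) bT.
rewrite linear_opZ// rnormE !rnormZ_real normfV ger0_norm ?rnorm_ge0//.
rewrite mulVf ?gt_eqF// => /(_ (lexx _)).
by rewrite mulrC ler_pdivrMr.
Qed.

End BoundedOperators.

(** * The real inner product, Cauchy-Schwarz and Riesz representation *)

Section HilbertSpace.
Set Implicit Arguments.
Unset Strict Implicit.
Context (R : realType) (H : completeNormedModType R[i]) 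
  (dot : {dot H for conjC}).
Hypothesis dot_norm : inner_product_norm dot.
Implicit Types (x y z : H) (t : R) (T U : H -> H).

(* The underlying real inner product space: [rdot] is its symmetric bilinear
   form and [rnorm] its norm. *)
Definition rdot x y : R := complex.Re (dot x y).

Lemma rdotC x y : rdot x y = rdot y x.
Proof.
apply: complexI; rewrite /rdot (hermC dot x y) expr0 mul1r.
by rewrite !complexRe Re_conj.
Qed.

Lemma rdotDl x y z : rdot (x + y) z = rdot x z + rdot y z.
Proof. by rewrite /rdot linearDl/=; case: (dot x z); case: (dot y z). Qed.

Lemma rdotZl t x y : rdot (t%:C%C *: x) y = t * rdot x y.
Proof.
by rewrite /rdot linearZl_LR/=; case: (dot x y) => a b /=; rewrite mul0r subr0.
Qed.

Lemma rdotDr x y z : rdot x (y + z) = rdot x y + rdot x z.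
Proof. by rewrite !(rdotC x) rdotDl. Qed.

Lemma rdotZr t x y : rdot x (t%:C%C *: y) = t * rdot x y.
Proof. by rewrite !(rdotC x) rdotZl. Qed.

Lemma rdotNl x y : rdot (- x) y = - rdot x y.
Proof. by rewrite -scaleN1r -[-1](rmorphN1 (real_complex R)) rdotZl mulN1r. Qed.

Lemma rdotNr x y : rdot x (- y) = - rdot x y.
Proof. by rewrite !(rdotC x) rdotNl. Qed.

Lemma rdot0l x : rdot 0 x = 0.
Proof. by rewrite /rdot linear0l. Qed.

Lemma rdot0r x : rdot x 0 = 0.
Proof. by rewrite rdotC rdot0l. Qed.

Lemma rdotxx x : rdot x x = rnorm x ^+ 2.
Proof. by apply: complexI; rewrite /rdot -dot_norm rnormE -rmorphXn. Qed.

Definition rdotE := (rdotDl, rdotDr, rdotNl, rdotNr, rdotZl, rdotZr).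

Lemma sqr_rnormD x y :
  rnorm (x + y) ^+ 2 = rnorm x ^+ 2 + 2 * rdot x y + rnorm y ^+ 2.
Proof. by rewrite -!rdotxx !rdotE (rdotC y x); ring. Qed.

(** Cauchy-Schwarz: the squared norm of |y|x - |x|y expands to 2|x||y|(|x||y| - <x, y>), and |x||y|
    cancels unless a vector is zero. *)
Lemma rdot_le x y : rdot x y <= rnorm x * rnorm y.
Proof.
have := sqr_ge0 (rnorm ((rnorm y)%:C%C *: x + (- rnorm x)%:C%C *: y)).
rewrite sqr_rnormD !rnormZ_real !rdotE normrN !ger0_norm ?rnorm_ge0// => h.
have [/eqP|x0] := eqVneq (rnorm x) 0.
  rewrite rnorm_eq0 => /eqP ->.
  by rewrite rdot0l rnorm0 mul0r.
have [/eqP|y0] := eqVneq (rnorm y) 0.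
  rewrite rnorm_eq0 => /eqP ->.
  by rewrite rdot0r rnorm0 mulr0.
have xy0 : 0 < rnorm x * rnorm y by rewrite mulr_gt0// lt0r ?x0 ?y0 rnorm_ge0.
rewrite -(ler_pM2l xy0); nra.
Qed.

Lemma ler_norm_rdot x y : `|rdot x y| <= rnorm x * rnorm y.
Proof. by rewrite ler_norml lerNl -rdotNl -{1}(rnormN x) !rdot_le. Qed.

(** Multiplying [x] by the conjugate of d = <x, y> turns the inner product into the real number
    |d|^2, so the real inequality gives |d|^2 <= |d||x||y|. *)
Lemma norm_dot_le x y : complex.Re `|dot x y| <= rnorm x * rnorm y.
Proof.
set d := dot x y; set n := complex.Re `|d|.
have nE : `|d| = n%:C%C by rewrite RRe_real ?normr_real.
have n0 : 0 <= n by rewrite -lecR -nE normr_ge0.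
have [->|nN0] := eqVneq n 0; first by rewrite mulr_ge0 ?rnorm_ge0.
have := rdot_le ((d^*)%R *: x) y.
rewrite /rdot linearZl_LR/= -/d mulrC -normCK nE -rmorphXn/=.
rewrite rnormZ norm_conjC -/n.
by rewrite -mulrA ler_pM2l// lt0r nN0.
Qed.

Lemma dot_ext x y : (forall z, dot x z = dot y z) -> x = y.
Proof.
move=> xy; apply/eqP; rewrite -subr_eq0 -(dnorm_eq0 dot) linearBl/=.
by rewrite xy subrr.
Qed.

(* Minimize |x|^2 - 2 f x: minimizing sequences are Cauchy by the parallelogram
   law, and the first variation at the minimum gives f. *)
Lemma riesz (f : H -> R) (M : R) :
  {morph f : x y / x + y} -> (forall t x, f (t%:C%C *: x) = t * f x) ->
  (forall x, `|f x| <= M * rnorm x) ->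
  exists z, forall x, f x = rdot x z.
Proof.
move=> fD fZ fM.
pose J x := rnorm x ^+ 2 - 2 * f x.
(* Completing the square: J x >= |x|^2 - 2M|x| = (|x| - M)^2 - M^2. *)
have J_lb x : - M ^+ 2 <= J x.
  have := le_trans (ler_norm _) (fM x); rewrite /J.
  by have := sqr_ge0 (rnorm x - M); nra.
pose m : R := inf (range J).
have has_infJ : has_inf (range J).
  split; first by exists (J 0), 0.
  by exists (- M ^+ 2) => _ [x _ <-].
have m_le x : m <= J x by apply: ge_inf; [case: has_infJ | exists x].
have [w w0 w_small] : exists2 w : nat -> R, (forall n, 0 < w n) &
    forall e : R, 0 < e -> exists N, forall n, (N <= n)%N -> w n < e.
  exists (fun n => n.+1%:R^-1) => [n|e e0]; first by rewrite invr_gt0.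
  by have [N _ uN] := near_infty_natSinv_lt (PosNum e0); exists N.
have /choice[u uP] : forall n : nat, exists x, J x < m + w n.
  move=> n; have [_ [x _ <-] ?] := @inf_adherent _ _ _ (w0 n) has_infJ.
  by exists x.
(* The linear terms of [J] cancel, which leaves the parallelogram law. *)
have parallelogram x y :
    rnorm (x - y) ^+ 2 = 2 * J x + 2 * J y - 4 * J ((2^-1)%:C%C *: (x + y)).
  by rewrite /J fZ fD -!rdotxx !rdotE (rdotC y x); field.
have [e /= e0|z uz] := @rnorm_complete _ _ u.
  (* As [J] is at least [m] at the midpoint, |u N - u n|^2 < 2(w N + w n), which is below e^2 once
     both slacks are below e^2/4. *)
  have [|N uN] := w_small (e ^+ 2 / 4); first by rewrite divr_gt0// exprn_gt0.
  exists N => n Nn.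
  rewrite -(@ltr_pXn2r _ 2) ?nnegrE ?rnorm_ge0 ?(ltW e0)// parallelogram.
  have := m_le ((2^-1)%:C%C *: (u N + u n)).
  have := uP N; have := uP n; have := uN N (leqnn N); have := uN n Nn.
  move: (w n) (w N) (J _) (J _) (J _) => *; lra.
exists z => h; apply/eqP; rewrite eq_sym -subr_eq0; set g := _ - _.
(* The right-hand side is J(z + th) - J z. The estimate is made at [u n], near [z], and holds up to
   w n + 2|t||h||z - u n|; the constant [c] makes this error at most [e]. *)
have gP t : 0 <= 2 * t * g + t ^+ 2 * rnorm h ^+ 2.
  apply/ler_addgt0Pr => e e0.
  pose c := 1 + 2 * `|t| * rnorm h.
  have c1 : 0 < c.
    by rewrite ltr_pwDl// mulr_ge0 ?rnorm_ge0// mulr_ge0.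
  have d0 : 0 < e / c by rewrite divr_gt0.
  have [N1 uN1] := w_small _ d0; have [N2 uN2] := uz _ d0.
  pose n := maxn N1 N2.
  have h1 := uN1 n (leq_maxl _ _); have h2 := uN2 n (leq_maxr _ _).
  have h3 := uP n; have := m_le (u n + t%:C%C *: h).
  rewrite /J fD fZ sqr_rnormD rdotZr rnormZ_real exprMn real_normK ?num_real//.
  rewrite -/(J _) => h4.
  have := rdot_le ((- t)%:C%C *: h) (z - u n).
  rewrite !rdotE (rdotC h (u n)) rnormZ_real normrN -(opprB (u n) z) rnormN.
  have th : 0 <= `|t| * rnorm h by rewrite mulr_ge0 ?rnorm_ge0.
  have := ler_wpM2l th (ltW h2).
  have : e = e / c + 2 * (`|t| * rnorm h * (e / c)).
    by rewrite /c; field; rewrite gt_eqF.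
  rewrite /J in h3; rewrite /g.
  lra.
have k0 := sqr_ge0 (rnorm h).
have k1 : rnorm h ^+ 2 + 1 != 0 by rewrite gt_eqF// ltr_pwDr.
(* Near the minimizer -g/|h|^2 of the quadratic in [t]; the added 1 avoids a separate case for h =
   0, and the value is still negative unless g = 0. *)
have := gP (- g / (rnorm h ^+ 2 + 1)).
move: (rnorm h ^+ 2) k0 k1 => k k0 k1.
have -> : 2 * (- g / (k + 1)) * g + (- g / (k + 1)) ^+ 2 * k =
    - ((k + 2) * (g / (k + 1)) ^+ 2) by field.
rewrite oppr_ge0 pmulr_rle0 ?ltr_wpDl// => gk.
have : (g / (k + 1)) ^+ 2 == 0 by rewrite eq_le gk sqr_ge0.
by rewrite sqrf_eq0 mulf_eq0 invr_eq0 (negPf k1) orbF.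
Qed.

(** * Adjoints of bounded operators *)

Lemma adjoint_unique T U :
  (forall x y, dot (T x) y = dot x (U y)) -> adjoint dot T = U.
Proof.
move=> TU; apply/funext => y; apply: dot_ext => z.
rewrite (hermC dot) [RHS](hermC dot) /= -TU; congr (_ * _^*).
by rewrite /adjoint; case: xgetP => [v -> /(_ z)|/(_ (U y))[]//].
Qed.

(** Riesz applied to v -> Re <Tv, y> yields a vector [z] matching real parts. Replacing v by iv
    matches the imaginary parts, so [z] is a witness and [xget] does not fall back on its
    default. *)
Lemma dot_adjoint T x y :
  bounded_operator T -> dot (T x) y = dot x (adjoint dot T y).
Proof.
move=> /bounded_operatorP[lT [M M0 TM]].
pose f x := rdot (T x) y.
have [|t v|v|z fz] := @riesz f (M * rnorm y).
- by move=> u v; rewrite /f linear_opD// rdotDl.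
- by rewrite /f linear_opZ// rdotZl.
- rewrite (le_trans (ler_norm_rdot _ _))// mulrAC.
  by rewrite ler_wpM2r ?rnorm_ge0.
suff Tz v : dot (T v) y = dot v z.
  by rewrite /adjoint; case: xgetP => [w -> /(_ x)//|/(_ z)[]].
have := fz v; have := fz ('i%C *: v).
rewrite /f linear_opZ// /rdot !linearZl_LR/=.
case: (dot (T v) y) (dot v z) => [a b] [c d] /=.
by rewrite !mul0r !mul1r !add0r => /oppr_inj -> ->.
Qed.

Lemma dot0l x : dot 0 x = 0.
Proof. exact: linear0l. Qed.

Lemma dotDl x y z : dot (x + y) z = dot x z + dot y z.
Proof. exact: linearDl. Qed.

Lemma dotDr x y z : dot x (y + z) = dot x y + dot x z.
Proof. exact: linearDr. Qed.

Lemma dotNl x y : dot (- x) y = - dot x y.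
Proof. exact: linearNl. Qed.

Lemma dotBl x y z : dot (x - y) z = dot x z - dot y z.
Proof. exact: linearBl. Qed.

Lemma dotBr x y z : dot x (y - z) = dot x y - dot x z.
Proof. exact: linearBr. Qed.

Lemma dotZl a x y : dot (a *: x) y = a * dot x y.
Proof. exact: linearZl_LR. Qed.

Lemma dotZr a x y : dot x (a *: y) = a^* * dot x y.
Proof. exact: linearZr_LR. Qed.

Lemma dotC x y : dot x y = (dot y x)^*.
Proof. by rewrite (hermC dot) expr0 mul1r. Qed.

Lemma adjoint_dot T x y :
  bounded_operator T -> dot (adjoint dot T x) y = dot x (T y).
Proof.
by move=> bT; rewrite (hermC dot) /= -dot_adjoint// [RHS](hermC dot).
Qed.

(** With T' the adjoint, |T'x|^2 = Re <x, TT'x> <= M|x||T'x|, and |T'x| cancels: [T] and T' share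
    the bound [M]. *)
Lemma bounded_adjoint T :
  bounded_operator T -> bounded_operator (adjoint dot T).
Proof.
move=> bT; have /bounded_operatorP[lT [M M0 TM]] := bT.
apply/bounded_operatorP; split.
  move=> a x y; apply: dot_ext => z.
  by rewrite adjoint_dot// !(dotDl, dotZl)/= !adjoint_dot.
exists M => // x; have [->|Tx0] := eqVneq (rnorm (adjoint dot T x)) 0.
  by rewrite mulr_ge0 ?rnorm_ge0.
have Tx_gt0 : 0 < rnorm (adjoint dot T x) by rewrite lt0r Tx0 rnorm_ge0.
rewrite -(ler_pM2l Tx_gt0) -expr2 -rdotxx /rdot adjoint_dot//.
rewrite (le_trans (rdot_le _ _))// mulrC mulrA (mulrC _ M).
by rewrite ler_wpM2r ?rnorm_ge0.
Qed.

Lemma adjoint_comp T U : bounded_operator T -> bounded_operator U ->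
  adjoint dot (T \o U) = adjoint dot U \o adjoint dot T.
Proof.
by move=> bT bU; apply: adjoint_unique => x y /=; rewrite !dot_adjoint.
Qed.

(** * Real and imaginary parts of an operator *)

Lemma bounded_re_op T : bounded_operator T -> bounded_operator (re_op dot T).
Proof.
move=> bT; apply: bounded_operatorZ; apply: bounded_operatorD => //.
exact: bounded_adjoint.
Qed.

Lemma bounded_im_op T : bounded_operator T -> bounded_operator (im_op dot T).
Proof.
move=> bT; apply: bounded_operatorZ; apply: bounded_operatorD => //.
exact/bounded_operatorN/bounded_adjoint.
Qed.

Lemma re_opE T x : re_op dot T x = 2^-1 *: (T x + adjoint dot T x).
Proof. by []. Qed.

Lemma im_opE T x : im_op dot T x = (2 * 'i)^-1 *: (T x - adjoint dot T x).
Proof. by []. Qed.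

Definition selfadjoint T := forall x y, dot (T x) y = dot x (T y).

Lemma re_op_selfadjoint T : bounded_operator T -> selfadjoint (re_op dot T).
Proof.
move=> bT x y; rewrite !re_opE dotZl dotZr/= dotDl dotDr/=.
by rewrite adjoint_dot// dot_adjoint// fmorphV rmorph_nat addrC.
Qed.

Lemma im_op_selfadjoint T : bounded_operator T -> selfadjoint (im_op dot T).
Proof.
move=> bT x y; rewrite !im_opE dotZl dotZr/= dotBl dotBr/=.
rewrite adjoint_dot// dot_adjoint// fmorphV rmorphM rmorph_nat/= conjCi.
by rewrite mulrN invrN mulNr -mulrN opprB.
Qed.

Lemma rdot_re_op T x : bounded_operator T ->
  rdot (re_op dot T x) x = complex.Re (dot (T x) x).
Proof.
move=> bT; rewrite /rdot re_opE dotZl dotDl adjoint_dot// (dotC x).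
by rewrite mulrC -ReE -complexRe.
Qed.

Lemma rdot_im_op T x : bounded_operator T ->
  rdot (im_op dot T x) x = complex.Im (dot (T x) x).
Proof.
move=> bT; rewrite /rdot im_opE dotZl dotBl adjoint_dot// (dotC x).
set d := dot (T x) x; have -> : (2 * 'i)^-1 * (d - d^*) = 'Im d.
  by rewrite ImE invfM invCi; ring.
by rewrite -complexIm.
Qed.

(** By polarization, 4<Tx, y> is the difference of the quadratic form at x + y and x - y, hence at
    most 2w(|x|^2 + |y|^2). Taking [y] parallel to Tx with |y| = |x| gives 4|x||Tx| <= 4w|x|^2. *)
Lemma selfadjoint_rnorm_le T (w : R) : linear T -> selfadjoint T -> 0 <= w ->
  (forall x, `|rdot (T x) x| <= w * rnorm x ^+ 2) ->
  forall x, rnorm (T x) <= w * rnorm x.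
Proof.
move=> lT sT w0 Tw x.
have [->|x0] := eqVneq x 0; first by rewrite linear_op0// rnorm0 mulr0.
have [->|n0] := eqVneq (rnorm (T x)) 0; first by rewrite mulr_ge0 ?rnorm_ge0.
have x_gt0 : 0 < rnorm x by rewrite lt0r rnorm_eq0 x0 rnorm_ge0.
have n_gt0 : 0 < rnorm (T x) by rewrite lt0r n0 rnorm_ge0.
have rTC u v : rdot (T u) v = rdot (T v) u.
  by rewrite {1}/rdot sT -/(rdot u (T v)) rdotC.
have polarization v : 4 * rdot (T x) v =
    rdot (T (x + v)) (x + v) - rdot (T (x - v)) (x - v).
  by rewrite !linear_opD// linear_opN// !rdotE (rTC v x); ring.
pose y := (rnorm x / rnorm (T x))%:C%C *: T x.
have yx : rnorm y = rnorm x.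
  by rewrite rnormZ_real ger0_norm ?divr_ge0 ?rnorm_ge0// divfK.
have Txy : rdot (T x) y = rnorm x * rnorm (T x).
  by rewrite rdotZr rdotxx expr2 mulrA divfK.
have := polarization y; rewrite Txy => Txy4.
have /ler_normlP[_ h1] := Tw (x + y); have /ler_normlP[h2 _] := Tw (x - y).
move: h1 h2; rewrite !sqr_rnormD rdotNr rnormN yx => h1 h2.
by rewrite -(ler_pM2l x_gt0); lra.
Qed.

(** * Numerical radius and Crawford number *)

Lemma numerical_radius_ge0 T : 0 <= numerical_radius dot T.
Proof.
rewrite /numerical_radius; set E := (X in sup X).
(* [sup] is 0 on sets that are empty or unbounded above, as happens when there are no unit
   vectors. *)
have [[E0 Eb]|] := pselect (has_sup E); last by move=> /sup_out ->.
have [e Ee] := E0; apply: le_trans (ub_le_sup Eb Ee); case: Ee => x _ <-.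
by rewrite -lecR RRe_real ?normr_real ?normr_ge0.
Qed.

Lemma unit_vector x : x != 0 ->
  exists2 u, `|u| = 1 & x = (rnorm x)%:C%C *: u.
Proof.
move=> x0; exists ((rnorm x)^-1%:C%C *: x); last first.
  by rewrite scalerA -rmorphM/= divff ?rnorm_eq0// scale1r.
rewrite rnormE rnormZ_real normfV ger0_norm ?rnorm_ge0//.
by rewrite mulVf ?rnorm_eq0.
Qed.

Lemma norm_real_complex t : `|t%:C%C| = `|t|%:C%C :> R[i].
Proof. by rewrite normc_def/= expr0n/= addr0 sqrtr_sqr. Qed.

Lemma norm_dotZ T (t : R) x : linear T ->
  complex.Re `|dot (T (t%:C%C *: x)) (t%:C%C *: x)| =
  t ^+ 2 * complex.Re `|dot (T x) x|.
Proof.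
move=> lT; rewrite linear_opZ// dotZl dotZr.
apply: complexI; rewrite rmorphM rmorphXn [LHS]RRe_real ?normr_real//.
rewrite !normrM norm_conjC norm_real_complex mulrA -expr2.
rewrite -[X in X * _]rmorphXn real_normK ?num_real// rmorphXn.
by congr (_ * _); rewrite [RHS]RRe_real ?normr_real.
Qed.

Lemma norm_dot_le_radius T x : bounded_operator T ->
  complex.Re `|dot (T x) x| <= numerical_radius dot T * rnorm x ^+ 2.
Proof.
move=> bT; have [lT _] := bT.
have [->|x0] := eqVneq x 0.
  by rewrite linear_op0// dot0l normr0 rnorm0 expr0n mulr0.
have [u u1 ->] := unit_vector x0.
have ru : rnorm u = 1 by rewrite /rnorm u1.
rewrite norm_dotZ// rnormZ_real ru mulr1 real_normK ?num_real// mulrC.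
rewrite ler_wpM2r ?sqr_ge0//; apply: ub_le_sup; last by exists u.
(* By Cauchy-Schwarz the operator norm bounds the set, so its supremum is a genuine one. *)
exists (opnorm T) => _ [v v1 <-].
rewrite (le_trans (norm_dot_le _ _))//.
have rv : rnorm v = 1 by rewrite /rnorm v1.
by have := rnorm_le_opnorm v bT; rewrite rv !mulr1.
Qed.

Lemma crawford_le T x : linear T ->
  crawford dot T * rnorm x ^+ 2 <= complex.Re `|dot (T x) x|.
Proof.
move=> lT; have [->|x0] := eqVneq x 0.
  by rewrite linear_op0// dot0l normr0 rnorm0 expr0n mulr0.
have [u u1 ->] := unit_vector x0.
have ru : rnorm u = 1 by rewrite /rnorm u1.
rewrite norm_dotZ// rnormZ_real ru mulr1 real_normK ?num_real// mulrC.
rewrite ler_wpM2l ?sqr_ge0//; apply: ge_inf; last by exists u.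
exists 0 => _ [v v1 <-].
by rewrite -lecR RRe_real ?normr_real ?normr_ge0.
Qed.

Lemma opnorm_re_op_le T : bounded_operator T ->
  opnorm (re_op dot T) <= numerical_radius dot T.
Proof.
move=> bT; have [lB _] := bounded_re_op bT.
apply: opnorm_le (numerical_radius_ge0 T) _.
apply: selfadjoint_rnorm_le => // [||x]; first exact: re_op_selfadjoint.
  exact: numerical_radius_ge0.
rewrite rdot_re_op// (le_trans _ (norm_dot_le_radius x bT))//.
by rewrite -lecR RRe_real ?normr_real ?normc_ge_Re.
Qed.

Lemma opnorm_im_op_le T : bounded_operator T ->
  opnorm (im_op dot T) <= numerical_radius dot T.
Proof.
move=> bT; have [lB _] := bounded_im_op bT.
apply: opnorm_le (numerical_radius_ge0 T) _.
apply: selfadjoint_rnorm_le => // [||x]; first exact: im_op_selfadjoint.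
  exact: numerical_radius_ge0.
rewrite rdot_im_op// (le_trans _ (norm_dot_le_radius x bT))//.
by rewrite normc_def/= -sqrtr_sqr ler_wsqrtr// lerDr sqr_ge0.
Qed.

End HilbertSpace.

(** * The Cartesian decomposition and the two operator norm estimates *)

Section Cartesian.
Set Implicit Arguments.
Unset Strict Implicit.
Context (R : realType) (H : completeNormedModType R[i]) 
  (dot : {dot H for conjC}).
Hypothesis dot_norm : inner_product_norm dot.
Context (A : H -> H) (bA : bounded_operator A).
Implicit Types (x y z : H).
Let B := re_op dot A.
Let C := im_op dot A.
Let P : H -> H := (adjoint dot A \o A) + (A \o adjoint dot A).
Let Q : H -> H := re_op dot (A \o A).

Let lA : linear A. Proof. by case: bA. Qed.
Let bA' := bounded_adjoint dot_norm bA.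
Let lA' : linear (adjoint dot A). Proof. by case: bA'. Qed.
Let bB := bounded_re_op dot_norm bA.
Let lB : linear B. Proof. by case: bB. Qed.
Let bC := bounded_im_op dot_norm bA.
Let lC : linear C. Proof. by case: bC. Qed.

(** Expanding this square and that of [C] into words in [A] and its adjoint makes [sum_sqrE] and
    [re_sqrE] linear identities between words. *)
Lemma re_op_sqr x : B (B x) = 4^-1 *: (A (A x) + A (adjoint dot A x) +
  adjoint dot A (A x) + adjoint dot A (adjoint dot A x)).
Proof.
rewrite /B !re_opE !(linear_opE lA, linear_opE lA') -scalerDr scalerA.
by rewrite -!addrA; congr (_ *: _); field.
Qed.

Lemma im_op_sqr x : C (C x) = 4^-1 *: (A (adjoint dot A x) +
  adjoint dot A (A x) - A (A x) - adjoint dot A (adjoint dot A x)).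
Proof.
rewrite /C !im_opE !(linear_opE lA, linear_opE lA') -scalerBr scalerA.
have -> : (2 * 'i)^-1 * (2 * 'i)^-1 = - 4^-1 :> R[i].
  by rewrite -invfM -expr2 exprMn sqrCi mulrN1 invrN -natrX.
rewrite scaleNr -scalerN; congr (_ *: _).
(* Pairing with an arbitrary [z] moves the vector identity into [R[i]], where [ring] applies. *)
by apply: (@dot_ext _ _ dot) => z; rewrite !(dotDl, dotBl, dotNl); ring.
Qed.

Lemma sum_sqrE x : P x = 2 *: (B (B x) + C (C x)).
Proof.
rewrite re_op_sqr im_op_sqr.
rewrite [LHS](_ : _ = adjoint dot A (A x) + A (adjoint dot A x))//.
by apply: (@dot_ext _ _ dot) => z; rewrite !(dotDl, dotBl, dotNl, dotZl); field.
Qed.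

Lemma re_sqrE x : Q x = B (B x) - C (C x).
Proof.
rewrite re_op_sqr im_op_sqr /Q re_opE adjoint_comp//=.
by apply: (@dot_ext _ _ dot) => z; rewrite !(dotDl, dotBl, dotNl, dotZl); field.
Qed.

(** In (B^2 + C^2)^2 + (B^2 - C^2)^2 the mixed products B^2 C^2 and C^2 B^2 cancel separately, so
    [B] and [C] need not commute. *)
Lemma sqr_sum_sqrE x : ((P \o P) + 4 *: (Q \o Q)) x =
  8 *: (B (B (B (B x))) + C (C (C (C x)))).
Proof.
rewrite [LHS](_ : _ = P (P x) + 4 *: Q (Q x))// !sum_sqrE !re_sqrE.
(* Generalizing leaves only linearity visible to the rewriting. *)
move: lB lC; generalize B C => B' C' lB' lC'.
rewrite !(linear_opE lB', linear_opE lC').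
by apply: (@dot_ext _ _ dot) => z; rewrite !(dotDl, dotNl, dotZl); ring.
Qed.

Lemma bounded_sum_sqr : bounded_operator P.
Proof. by apply: bounded_operatorD; exact: bounded_operator_comp. Qed.

Lemma bounded_re_sqr : bounded_operator Q.
Proof. exact/bounded_re_op/bounded_operator_comp. Qed.

Lemma sum_sqr_selfadjoint : selfadjoint dot P.
Proof.
move=> x y; rewrite [P x](_ : _ = adjoint dot A (A x) + A (adjoint dot A x))//.
rewrite [P y](_ : _ = adjoint dot A (A y) + A (adjoint dot A y))//.
by rewrite dotDl dotDr !(adjoint_dot, dot_adjoint)// addrC.
Qed.

Lemma opnorm_sqr_sum_sqr_le :
  opnorm ((P \o P) + 4 *: (Q \o Q)) <= 8 * (opnorm B ^+ 4 + opnorm C ^+ 4).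
Proof.
have b0 : 0 <= opnorm B := opnorm_ge0 bB.
have c0 : 0 <= opnorm C := opnorm_ge0 bC.
have pow4 T x : bounded_operator T ->
    rnorm (T (T (T (T x)))) <= opnorm T ^+ 4 * rnorm x.
  move=> bT; have n0 := opnorm_ge0 bT; rewrite !exprS expr0 mulr1 -!mulrA.
  by do 3!(apply: le_trans (rnorm_le_opnorm _ bT) _; apply: ler_wpM2l => //);
    exact: rnorm_le_opnorm.
apply: opnorm_le => [|x]; first by rewrite mulr_ge0// addr_ge0 ?exprn_ge0.
rewrite sqr_sum_sqrE -(rmorph_nat (real_complex R)) rnormZ_real ger0_norm//.
rewrite -mulrA ler_wpM2l// mulrDl (le_trans (rnormD _ _))//.
by rewrite lerD ?pow4.
Qed.

(** Since <Q^2 x, x> = |Qx|^2 is its own modulus, it is at least c|x|^2. With T = P^2 + 4Q^2 this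
    gives |Px|^2 <= (|T| - 4c)|x|^2, so the norm of [P] is at most the square root of |T| - 4c. *)
Lemma opnorm_sqr_sum_sqr_ge :
  opnorm P ^+ 2 + 4 * crawford dot (Q \o Q) <=
  opnorm ((P \o P) + 4 *: (Q \o Q)).
Proof.
set T := (X in _ <= opnorm X); set c := crawford _ _.
have bP := bounded_sum_sqr; have bQ := bounded_re_sqr.
have bT : bounded_operator T.
  apply: bounded_operatorD; last apply: bounded_operatorZ;
    exact: bounded_operator_comp.
have sQ : selfadjoint dot Q by exact/re_op_selfadjoint/bounded_operator_comp.
have lQQ : linear (Q \o Q) by case: (bounded_operator_comp bQ bQ).
have Pc x : rnorm (P x) ^+ 2 <= (opnorm T - 4 * c) * rnorm x ^+ 2.
  have := crawford_le dot x lQQ.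
  rewrite [(Q \o Q) x]/= sQ -dot_norm rnormE -(rmorphXn (real_complex R)).
  rewrite norm_real_complex/= ger0_norm ?sqr_ge0// -/c => cx.
  have Tx : rdot dot (T x) x = rnorm (P x) ^+ 2 + 4 * rnorm (Q x) ^+ 2.
    rewrite [T x](_ : _ = P (P x) + 4 *: Q (Q x))//.
    rewrite -(rmorph_nat (real_complex R)) rdotDl rdotZl -!(rdotxx dot_norm).
    by rewrite /rdot sum_sqr_selfadjoint sQ.
  have := rdot_le dot_norm (T x) x; rewrite Tx.
  have := ler_wpM2r (rnorm_ge0 x) (rnorm_le_opnorm x bT).
  by lra.
(* The square root needs a nonnegative radicand: [Pc] at a unit vector provides it, and without unit
   vectors [c] is the infimum of the empty set, which is 0 by convention. *)
have Tc : 0 <= opnorm T - 4 * c.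
  have [[x x1]|H0] := pselect (exists x : H, `|x| = 1).
    have := Pc x; rewrite [rnorm x]/rnorm x1 expr1n mulr1.
    exact/le_trans/sqr_ge0.
  have -> : c = 0.
    rewrite /c /crawford; set E := (X in image X).
    have -> : E = set0 by apply/seteqP; split=> x //= x1; apply: H0; exists x.
    by rewrite image_set0 inf0.
  by rewrite mulr0 subr0 opnorm_ge0.
rewrite -lerBrDr -[leRHS]sqr_sqrtr// ler_pXn2r ?nnegrE ?sqrtr_ge0 ?opnorm_ge0//.
apply: opnorm_le => [|x]; first exact: sqrtr_ge0.
rewrite -(@ler_pXn2r _ 2) ?nnegrE ?mulr_ge0 ?sqrtr_ge0 ?rnorm_ge0//.
by rewrite exprMn sqr_sqrtr.
Qed.

End Cartesian.

Theorem theorem2p18 (R : realType) (H : completeNormedModType R[i])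
    (dot : {dot H for conjC}) (dot_norm : inner_product_norm dot)
    (A : H -> H) (bA : bounded_operator A) :
  let Astar := adjoint dot A in
  let P : H -> H := (Astar \o A) + (A \o Astar) in
  let Q : H -> H := re_op dot (A \o A) in
  let S : R := 1 / 16 * opnorm ((P \o P) + 4 *: (Q \o Q)) in
  let D : R := 1 / 2 * `|opnorm (re_op dot A) ^+ 4 - opnorm (im_op dot A) ^+ 4| in
  numerical_radius dot A ^+ 4 >= S + D /\
  S + D >= 1 / 16 * opnorm P ^+ 2 + 1 / 4 * crawford dot (Q \o Q) + D.
Proof.
move=> Astar P Q S D; split; last first.
  (* Once [D] is cancelled, this is [opnorm_sqr_sum_sqr_ge] divided by 16. *)
  by rewrite lerD2r; have := opnorm_sqr_sum_sqr_ge dot_norm bA; rewrite /S; lra.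
have w0 := numerical_radius_ge0 dot A.
have b0 := opnorm_ge0 (bounded_re_op dot_norm bA).
have c0 := opnorm_ge0 (bounded_im_op dot_norm bA).
have bw : opnorm (re_op dot A) ^+ 4 <= numerical_radius dot A ^+ 4.
  by rewrite ler_pXn2r ?nnegrE// opnorm_re_op_le.
have cw : opnorm (im_op dot A) ^+ 4 <= numerical_radius dot A ^+ 4.
  by rewrite ler_pXn2r ?nnegrE// opnorm_im_op_le.
have := opnorm_sqr_sum_sqr_le dot_norm bA.
by rewrite /S /D; case: (lerP (opnorm (re_op dot A) ^+ 4)) => bc; lra.
Qed.
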